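(* Let $n\ge 2$ and let $P$ be a set of $2n$ points in general position in the plane such that each point of $P$ lies on exactly one halving line of $P$. Then for each $t\in\{0,1\}$, the edges of the complete geometric graph on $P$ can be partitioned into $n$ plane spanning trees each graph-isomorphic to $S_{2t}(n-t,n-t)$.
   Context: General position: no three points collinear. The complete geometric graph on $P$ has vertex set $P$ and every pair of points joined by a straight-line segment; a plane spanning tree is a spanning tree of it whose edges pairwise do not cross (meet only at common endpoints). A halving line of a set $P$ of $2n$ points is a line through two points of $P$ leaving exactly $n-1$ points of $P$ strictly on each side. For $t\in\{0,1\}$, $S_{2t}(m,m)$ denotes the tree consisting of two vertices $a,b$ of degree $m$ joined by a path of length $2t+1$ (whose $2t$ internal vertices have degree $2$), all remaining vertices being leaves adjacent to $a$ or $b$; thus $S_{2t}(n-t,n-t)$ has exactly $2n$ vertices ($S_0(n,n)$ is the double star in which two adjacent vertices each have $n-1$ leaves, and $S_2(n-1,n-1)$ is obtained from a double star by subdividing the central edge twice). A partition of the edges means the edge sets of the trees are pairwise disjoint with union all edges. *)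

(* Defs.v *)
From HB Require Import structures.
From mathcomp Require Import all_boot all_order all_algebra finmap.
From mathcomp Require Import classical_sets reals.
Set Implicit Arguments.
Unset Strict Implicit.
Unset Printing Implicit Defensive.
Import Order.TTheory GRing.Theory Num.Theory.
Local Open Scope ring_scope.

Section Plane.
Variable R : realType.
Notation point := 'rV[R]_2.
Implicit Types (p q r x : point) (P : {fset point}).

(* Twice the signed area of the triangle p q r; for p <> q its sign tells on
   which side of the line through p and q the point r lies. *)
Definition orient p q r : R :=
  (q 0 0 - p 0 0) * (r 0 1 - p 0 1) - (q 0 1 - p 0 1) * (r 0 0 - p 0 0).

(* Meaningful as a line only for p <> q. *)
Definition line p q : set point := [set x : point | orient p q x = 0]%classic.

Definition segment p q : set point :=
  [set x : point | exists2 s : R, 0 <= s <= 1 & x = (1 - s) *: p + s *: q]%classic.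

Definition general_position P : Prop :=
  forall p q r, p \in P -> q \in P -> r \in P ->
    p != q -> p != r -> q != r -> ~ line p q r.

(* The line L is a set of points, so that {p, q} and {q, p} yield one line. *)
Definition halving_line (n : nat) P (L : set point) : Prop :=
  exists p q, [/\ p \in P, q \in P, p != q & L = line p q] /\
    #|` [fset x in P | 0 < orient p q x]%fset|%fset = (n - 1)%N /\
    #|` [fset x in P | orient p q x < 0]%fset|%fset = (n - 1)%N.

(* For distinct edges, any common point of the two segments is an endpoint of
   both. *)
Definition plane P (E : {set {set P}}) : Prop :=
  forall u v w z : P, [set u; v] \in E -> [set w; z] \in E ->
    [set u; v] != [set w; z] ->
    forall x, segment (val u) (val v) x -> segment (val w) (val z) x ->
      exists2 y : P, y \in [set u; v] :&: [set w; z] & x = val y.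

End Plane.

Section Graphs.

(* A graph on the vertex set V is given by its set of edges, which are
   two-element subsets of V. *)
Definition complete_edges (V : finType) : {set {set V}} :=
  [set e : {set V} | #|e| == 2%N].

Definition adj (V : finType) (E : {set {set V}}) : rel V :=
  [rel u v | [set u; v] \in E].

Definition edge_partition (V : finType) (n : nat) (T : 'I_n -> {set {set V}})
    : Prop :=
  (forall i j, i != j -> [disjoint T i & T j]) /\
  \bigcup_(i < n) T i = complete_edges V.

Definition connected_graph (V : finType) (E : {set {set V}}) : Prop :=
  forall u v : V, connect (adj E) u v.

Definition acyclic_graph (V : finType) (E : {set {set V}}) : Prop :=
  forall c : seq V, (2 < size c)%N -> ~ ucycle (adj E) c.

(* Spanning, since V is the vertex set of the whole graph. *)
Definition spanning_tree (V : finType) (E : {set {set V}}) : Prop :=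
  [/\ E \subset complete_edges V, connected_graph E & acyclic_graph E].

Definition graph_iso (V W : finType) (e : rel V) (e' : rel W) : Prop :=
  exists2 f : V -> W, bijective f & forall u v, e' (f u) (f v) = e u v.

(* The tree S_k(m1, m2): a path with vertices 0, ..., k + 1 (so a = 0, b = k + 1,
   with k internal vertices and length k + 1), together with m1 - 1 leaves
   attached to a and m2 - 1 leaves attached to b; thus, for m1, m2 >= 1, the
   degrees of a and b are m1 and m2. *)
Definition dstar_vertex (k m1 m2 : nat) : finType :=
  ('I_k.+2 + ('I_(m1 - 1) + 'I_(m2 - 1)))%type.

Definition dstar_rel (k m1 m2 : nat) : rel (dstar_vertex k m1 m2) :=
  fun u v => match u, v with
  | inl i, inl j => (j == i.+1 :> nat) || (i == j.+1 :> nat)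
  | inl i, inr (inl _) | inr (inl _), inl i => i == ord0
  | inl i, inr (inr _) | inr (inr _), inl i => i == ord_max
  | inr _, inr _ => false
  end.

End Graphs.

(* Main.v *)
Require Import Defs.
From HB Require Import structures.
From mathcomp Require Import classical_sets reals.
From mathcomp Require Import all_boot all_order all_algebra finmap.
From mathcomp Require Import ring lra zify.
Set Implicit Arguments.
Unset Strict Implicit.
Unset Printing Implicit Defensive.
Import Order.TTheory GRing.Theory Num.Theory.
Local Open Scope ring_scope.

(** Let [m p] be the other point of [P] on the halving line through [p], and let
   [L p] be the set of points to the left of the line directed from [p] to [m p].
   Rotate a line about [p], starting from its halving line: the number of points
   on its left changes by one at each point of [P] it meets, and it cannot go
   through the balanced value without creating a second halving line. Hence for
   [q] in [L p] fewer than [n - 1] points lie to the left of [p q]. Therefore,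
   for [q] distinct from [p] and [m p], exactly one of [q] in [L p] and [p] in
   [L q] holds. This says at once that the halving segments pairwise cross and
   that the stars with centre [p] and leaves [L p] partition the edges that are
   not halving segments.
   For t = 0, the tree of a pair {p, m p} consists of the edge {p, m p} and the
   stars of [p] and [m p]. For t = 1, the edge {p, m p} is replaced by the halving
   segment {s p, s (m p)} which comes next in the cyclic order of the slopes: no
   point lies in the double wedge between consecutive halving lines, so this
   segment crosses no edge of the two stars. *)

(** * Counting in a rotational sweep *)

(* Points of the plane other than a pivot, sorted by the cotangent [k] of the
   angle of their line through the pivot; [s] selects those in the upper half
   plane. Then [cnt x] counts the points to the left of the upward directed line
   through the pivot and [x]. *)
Lemma sweep_card_lt (T : finType) (R : realDomainType) (A : {set T})
    (s : pred T) (k : T -> R) (N : nat) :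
  let cnt x := (#|[set y in A | s y & (k y < k x)%R]|
                + #|[set y in A | ~~ s y & (k x < k y)%R]|)%N in
  {in A &, injective k} -> (#|[set y in A | s y]| <= N)%N ->
  {in A, forall x, cnt x <> N} -> {in A, forall x, (cnt x < N)%N}.
Proof.
move=> cnt kinj leN neN x.
have [h] := ubnP #|[set y in A | k x < k y]|.
elim: h x => // h IH x /ltnSE leh xA.
rewrite ltn_neqAle; apply/andP; split; first by apply/eqP; apply: neN.
(* If no key exceeds that of [x], the second count vanishes and [leN] bounds the first. Otherwise
   [z] below is the point with the next larger key. *)
have [B0|[z0 z0B]] := set_0Vmem [set y in A | k x < k y].
  apply: leq_trans leN; rewrite /cnt [X in (_ + X)%N](_ : _ = 0)%N ?addn0.
    by apply/subset_leq_card/subsetP => y; rewrite !inE => /and3P[-> ->].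
  apply/eqP; rewrite cards_eq0 -subset0 -B0; apply/subsetP => y.
  by rewrite !inE => /and3P[-> _ ->].
case: (@Order.TotalTheory.arg_minP _ _ _ z0 
  (fun z => z \in [set y in A | k x < k y]) k z0B).
move=> z; rewrite inE => /andP[zA xz] zmin.
have {}IH : (cnt z < N)%N.
  apply: IH => //; apply: leq_trans leh; apply: proper_card; apply/properP.
  split; last by exists z; rewrite !inE ?zA ?xz ?ltxx.
  by apply/subsetP => y; rewrite !inE => /andP[-> /(lt_trans xz)].
(* On going from [z] back to [x] only [z] itself can be newly counted, so the count grows by at most
   one; the value [N] is already excluded. *)
apply: leq_trans IH; rewrite /cnt -addnS; apply: leq_add.
  apply/subset_leq_card/subsetP => y; rewrite !inE => /and3P[-> -> yx] /=.
  exact: lt_trans xz.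
set B := [set y in A | _ & k z < k y].
apply: (@leq_trans #|z |: B|); last by rewrite cardsU1; case: (z \in B).
apply/subset_leq_card/subsetP => y; rewrite !inE => /and3P[yA -> xy] /=.
rewrite yA /= lt_neqAle zmin ?inE ?yA ?xy // andbT.
by case: eqVneq => //= yz; apply/eqP => /kinj zy; rewrite zy ?eqxx in yz.
Qed.

(** * Spanning trees from an isomorphism with the model tree *)

Section TreeTransfer.
Variable V : finType.

Implicit Types (u v w : V).

(** At a vertex of maximal rank on a cycle both cyclic neighbours have no larger rank, so they would
    coincide. *)
Lemma rank_acyclic (E : {set {set V}}) (r : V -> nat) :
  (forall u v w, adj E u v -> adj E u w -> (r v <= r u)%N -> (r w <= r u)%N ->
     v = w) -> acyclic_graph E.
Proof.
move=> rE c c2 /andP[cyc uc].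
have [x0 x0c] : exists x, x \in c by case: c c2 {cyc uc} => // x; exists x;
    rewrite mem_head.
case: (@arg_maxnP _ x0 (mem c) r x0c) => x xc xmax.
have [i s es] := rot_to xc.
have sc : x :: s =i c by move=> y; rewrite -es mem_rot.
move: uc cyc c2; rewrite -(rot_uniq i) -(rot_cycle i) -(size_rot i) es.
case: s es sc => // y s es sc /= /and3P[_ ys _] /andP[xy].
rewrite rcons_path => /andP[_ lx] s2.
have : y = last y s.
  apply: rE xy _ _ _; first by move: lx; rewrite /adj /= setUC.
    by apply: xmax; rewrite /= -sc !inE eqxx orbT.
  by apply: xmax; rewrite /= -sc inE mem_last orbT.
case: s s2 ys {es sc lx} => // z s _ ys elast.
by case/negP: ys; rewrite {1}elast /= mem_last.
Qed.

Lemma rank_connected (e : rel V) (r : V -> nat) (v0 : V) :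
  symmetric e -> (forall u, u != v0 -> exists2 v, e u v & (r v < r u)%N) ->
  forall u v, connect e u v.
Proof.
move=> esym dec u v.
have cv0 w : connect e w v0.
  have [h] := ubnP (r w); elim: h w => // h IH w /ltnSE rw.
  have [->|/dec[x wx xw]] := eqVneq w v0; first exact: connect0.
  by apply: connect_trans (connect1 wx) (IH x (leq_trans xw rw)).
by apply: connect_trans (cv0 u) _; rewrite (sym_connect_sym esym) cv0.
Qed.

End TreeTransfer.

Lemma adj_sym (V : finType) (E : {set {set V}}) : symmetric (adj E).
Proof. by move=> u v; rewrite /adj /= setUC. Qed.

(** The rank is the position on the central path, and [k.+2] for all leaves. Every vertex except the
    start of the path then has exactly one neighbour of no larger rank, which gives both
    connectedness and acyclicity. *)
Lemma dstar_iso_tree (V : finType) (E : {set {set V}}) (k m1 m2 : nat) :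
  E \subset complete_edges V -> graph_iso (adj E) (@dstar_rel k m1 m2) ->
  spanning_tree E.
Proof.
move=> Esub [f [g fK gK] fE].
pose r (u : V) := if f u is inl i then nat_of_ord i else k.+2.
split=> //.
- apply: (@rank_connected _ _ r (g (inl ord0)) (@adj_sym _ E)) => u u0.
  have {u0} fu0 : f u != inl ord0 by apply: contra_neq u0 => <-; rewrite fK.
  suff [w ew rw] : exists2 w, @dstar_rel k m1 m2 (f u) w &
      ((if w is inl i then nat_of_ord i else k.+2) < r u)%N.
    by exists (g w); rewrite -?fE /r gK.
  rewrite /r; case: (f u) fu0 => [[[|i] hi]|[j|j]] fu0.
  + by case/eqP: fu0; congr inl; apply: val_inj.
  + by exists (inl (Ordinal (ltnW hi))); rewrite //= eqxx orbT.
  + by exists (inl ord0).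
  + by exists (inl ord_max); rewrite //= eqxx.
- apply: (rank_acyclic (r := r)) => u v w.
  rewrite -!fE /r => uv uw rv rw; apply: (can_inj fK).
  case: (f u) (f v) (f w) uv uw rv rw => [i|[i|i]] [j|[j|j]] [l|[l|l]];
    rewrite ?(ltn_geF (ltn_ord _)) //=.
  + move=> /orP[]/eqP ij /orP[]/eqP il ji li; congr inl; apply: val_inj => /=;
      lia.
  + by move=> /eqP-> /eqP->.
  + by move=> /eqP-> /eqP->.
Qed.

(** The path is placed by [c], the leaves by enumerating [A] and [B]. The resulting map is
    injective, and the count of [V] makes it bijective. *)
Lemma dstar_iso (V : finType) (E : {set {set V}}) (k m1 m2 : nat)
    (c : 'I_k.+2 -> V) (A B : {set V}) :
  #|V| = (k.+2 + ((m1 - 1) + (m2 - 1)))%N ->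
  #|A| = (m1 - 1)%N -> #|B| = (m2 - 1)%N ->
  injective c -> (forall i, c i \notin A :|: B) -> [disjoint A & B] ->
  (forall i j, adj E (c i) (c j) = (j == i.+1 :> nat) || (i == j.+1 :> nat)) ->
  (forall i, {in A, forall z, adj E (c i) z = (i == ord0)}) ->
  (forall i, {in B, forall z, adj E (c i) z = (i == ord_max)}) ->
  {in A :|: B &, forall z w, adj E z w = false} ->
  graph_iso (adj E) (@dstar_rel k m1 m2).
Proof.
move=> cardV cardA cardB cinj cAB dAB Ecc EcA EcB EAB.
pose gA j : V := enum_val (cast_ord (esym cardA) j).
pose gB j : V := enum_val (cast_ord (esym cardB) j).
have gAA j : gA j \in A by apply: enum_valP.
have gBB j : gB j \in B by apply: enum_valP.
pose g (u : dstar_vertex k m1 m2) : V :=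
  match u with inl i => c i | inr (inl j) => gA j | inr (inr j) => gB j end.
have notA j i : gA j <> c i.
  by move=> e; have := cAB i; rewrite -e inE gAA.
have notB j i : gB j <> c i.
  by move=> e; have := cAB i; rewrite -e inE gBB orbT.
have notAB i j : gA i <> gB j.
  by move=> e; have := disjointFr dAB (gAA i); rewrite e gBB.
have ginj : injective g.
  move=> [i|[i|i]] [j|[j|j]] /=.
  - by move=> /cinj ->.
  - by move=> /esym /notA.
  - by move=> /esym /notB.
  - by move=> /notA.
  - by move=> /enum_val_inj /cast_ord_inj ->.
  - by move=> /notAB.
  - by move=> /notB.
  - by move=> /esym /notAB.
  - by move=> /enum_val_inj /cast_ord_inj ->.
have gE u v : adj E (g u) (g v) = @dstar_rel k m1 m2 u v.
  case: u v => [i|[i|i]] [j|[j|j]] /=;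
    first [by rewrite Ecc | by rewrite EcA | by rewrite EcB
       | by rewrite adj_sym EcA | by rewrite adj_sym EcB
       | by rewrite EAB // inE ?gAA ?gBB ?orbT].
have [f fK gK] : bijective g.
  by apply: inj_card_bij ginj _; rewrite cardV !card_sum !card_ord.
by exists f; [exists g | move=> u v; rewrite -gE !gK].
Qed.

(** * Two stars and one further edge *)

Lemma eq_set2 (V : finType) (u v w z : V) :
  ([set u; v] == [set w; z]) = ((u == w) && (v == z)) || ((u == z) && (v == w)).
Proof.
apply/eqP/idP => [/setP e|]; last first.
  by case/orP=> /andP[/eqP-> /eqP->] //; rewrite setUC.
move: (e u) (e v) (e w) (e z); rewrite !inE !eqxx ?orbT /= !(eq_sym w)
    !(eq_sym z).
by case: (u == w); case: (u == z); case: (v == w); case: (v == z).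
Qed.

Section Stars.
Variable V : finType.
Implicit Types (e : {set V}) (a b u v : V) (A B : {set V}).

Definition star a A : {set {set V}} := [set [set a; z] | z in A].

(** Common shape of both kinds of trees: [e] is the edge between the centres for t = 0, and an edge
    from a point of [A] to a point of [B] for t = 1. *)
Definition stars e a b A B : {set {set V}} := e |: (star a A :|: star b B).

Lemma adj_star a A u v :
  ([set u; v] \in star a A) = (u == a) && (v \in A) || (v == a) && (u \in A).
Proof.
apply/imsetP/idP => [[z zA /eqP]|/orP[]/andP[/eqP-> h]].
- by rewrite eq_set2 => /orP[]/andP[/eqP-> /eqP->]; rewrite eqxx zA ?orbT.
- by exists v.
- by exists u; rewrite // setUC.
Qed.

Lemma adj_stars e a b A B u v :
  adj (stars e a b A B) u v =
  [|| [set u; v] == e, (u == a) && (v \in A), (v == a) && (u \in A),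
      (u == b) && (v \in B) | (v == b) && (u \in B)].
Proof. by rewrite /adj /stars /= !inE !adj_star -!orbA. Qed.

Lemma stars_sub e a b A B : #|e| = 2 -> a \notin A -> b \notin B ->
  stars e a b A B \subset complete_edges V.
Proof.
move=> e2 aA bB; apply/subsetP => d; rewrite !inE.
case/or3P=> [/eqP->|/imsetP[z zA ->]|/imsetP[z zA ->]]; first by rewrite e2.
  by rewrite cards2 (_ : a != z) //; apply: contraNneq aA => ->.
by rewrite cards2 (_ : b != z) //; apply: contraNneq bB => ->.
Qed.

Variables (a b : V) (A B : {set V}).
Hypotheses (ab : a != b) (dAB : [disjoint A & B]).
Hypotheses (aA : a \notin A) (aB : a \notin B).
Hypotheses (bA : b \notin A) (bB : b \notin B).

Lemma stars_iso0 (n : nat) : (0 < n)%N -> #|V| = (2 * n)%N ->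
  #|A| = (n - 1)%N -> #|B| = (n - 1)%N ->
  graph_iso (adj (stars [set a; b] a b A B)) (@dstar_rel 0 n n).
Proof.
move=> n0 cV cA cB.
pose c (i : 'I_2) := tnth [tuple a; b] i.
have zA z : z \in A ->
    ((z == a) = false) * ((z == b) = false) * ((z \in B) = false).
  move=> zA; rewrite (disjointFr dAB zA).
  have za : (z == a) = false by apply: contraNF (aA); move/eqP<-.
  have zb : (z == b) = false by apply: contraNF (bA); move/eqP<-.
  by [].
have zB z : z \in B ->
    ((z == a) = false) * ((z == b) = false) * ((z \in A) = false).
  move=> zB; rewrite (disjointFl dAB zB).
  have za : (z == a) = false by apply: contraNF (aB); move/eqP<-.
  have zb : (z == b) = false by apply: contraNF (bB); move/eqP<-.
  by [].
have ba : (b == a) = false by rewrite eq_sym (negPf ab).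
have abF := negPf ab.
have aAF := negPf aA; have bAF := negPf bA.
have aBF := negPf aB; have bBF := negPf bB.
apply: (dstar_iso (c := c) (A := A) (B := B)) => //.
- by rewrite cV; lia.
- by apply/tuple_uniqP; rewrite /= inE ab.
- by case=> [[|[|i]] hi] //; rewrite /c (tnth_nth a) /= inE negb_or ?aA ?bA.
- by case=> [[|[|i]] hi] [[|[|j]] hj] //=; rewrite /c !(tnth_nth a) /= adj_stars
    eq_set2 ?eqxx ?ba ?abF ?aAF ?bAF ?aBF ?bBF.
- by case=> [[|[|i]] hi] z zz //; rewrite /c (tnth_nth a) /= adj_stars eq_set2
    ?eqxx ?ba ?abF ?aAF ?bAF ?aBF ?bBF !(zA z) // zz.
- by case=> [[|[|i]] hi] z zz //; rewrite /c (tnth_nth a) /= adj_stars eq_set2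
    ?eqxx ?ba ?abF ?aAF ?bAF ?aBF ?bBF !(zB z) // zz.
- by move=> z w; rewrite !inE adj_stars eq_set2 => /orP[/zA|/zB]hz
    /orP[/zA|/zB]hw;
  rewrite !hz !hw.
Qed.

(** The central path is [a], [x], [y], [b]: its outer edges come from the stars, and [x] and [y]
    stop being leaves. *)
Lemma stars_iso2 (n : nat) (x y : V) : (1 < n)%N -> #|V| = (2 * n)%N ->
  #|A| = (n - 1)%N -> #|B| = (n - 1)%N -> x \in A -> y \in B ->
  graph_iso (adj (stars [set x; y] a b A B)) (@dstar_rel 2 (n - 1) (n - 1)).
Proof.
move=> n1 cV cA cB xA yB.
pose c (i : 'I_4) := tnth [tuple a; x; y; b] i.
have zA z : z \in A ->
    ((z == a) = false) * ((z == b) = false) * ((z \in B) = false) *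
    ((z == y) = false) * ((a == z) = false) * ((b == z) = false).
  move=> zA; rewrite (eq_sym a) (eq_sym b) (disjointFr dAB zA).
  have za : (z == a) = false by apply: contraNF (aA); move/eqP<-.
  have zb : (z == b) = false by apply: contraNF (bA); move/eqP<-.
  have zy : (z == y) = false by apply: contraTF yB; move/eqP<-;
      rewrite (disjointFr dAB zA).
  by [].
have zB z : z \in B ->
    ((z == a) = false) * ((z == b) = false) * ((z \in A) = false) *
    ((z == x) = false) * ((a == z) = false) * ((b == z) = false).
  move=> zB; rewrite (eq_sym a) (eq_sym b) (disjointFl dAB zB).
  have za : (z == a) = false by apply: contraNF (aB); move/eqP<-.
  have zb : (z == b) = false by apply: contraNF (bB); move/eqP<-.
  have zx : (z == x) = false by apply: contraTF xA; move/eqP<-;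
      rewrite (disjointFl dAB zB).
  by [].
have ba : (b == a) = false by rewrite eq_sym (negPf ab).
have abF := negPf ab.
have aAF := negPf aA; have bAF := negPf bA.
have aBF := negPf aB; have bBF := negPf bB.
pose xE := zA x xA; pose yE := zB y yB.
apply: (dstar_iso (c := c) (A := A :\ x) (B := B :\ y)) => //.
- by rewrite cV; lia.
- by have := cardsD1 x A; rewrite xA cA; lia.
- by have := cardsD1 y B; rewrite yB cB; lia.
- apply/tuple_uniqP => /=.
  by rewrite !inE abF !xE !yE.
- case=> [[|[|[|[|i]]]] hi] //; rewrite /c (tnth_nth a) /= !inE
   ?eqxx ?xE ?yE ?aAF ?bAF ?aBF ?bBF ?andbF //.
- by apply: disjointWl (subD1set _ _) _; apply: disjointWr (subD1set _ _) _.
- by case=> [[|[|[|[|i]]]] hi] [[|[|[|[|j]]]] hj] //=;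
    rewrite /c !(tnth_nth a) /= adj_stars eq_set2
    ?eqxx ?ba ?abF ?aAF ?bAF ?aBF ?bBF ?xA ?yB ?xE ?yE ?orbT.
- by case=> [[|[|[|[|i]]]] hi] z; rewrite !inE => /andP[/negPf zx zz] //;
    rewrite /c (tnth_nth a) /= adj_stars eq_set2
    ?eqxx ?ba ?abF ?aAF ?bAF ?aBF ?bBF !(zA z zz) ?zx ?xE ?yE ?zz ?orbT ?andbF.
- by case=> [[|[|[|[|i]]]] hi] z; rewrite !inE => /andP[/negPf zx zz] //;
    rewrite /c (tnth_nth a) /= adj_stars eq_set2
    ?eqxx ?ba ?abF ?aAF ?bAF ?aBF ?bBF !(zB z zz) ?zx ?xE ?yE ?zz ?orbT ?andbF.
- have off z : z \in (A :\ x) :|: (B :\ y) ->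
      ((z == a) = false) * ((z == b) = false) * ((z == x) = false).
    by rewrite !inE => /orP[]/andP[/negPf zx]; [move/zA | move/zB] => zz;
        rewrite !zz ?zx.
  by move=> z w /off hz /off hw; rewrite adj_stars eq_set2 !hz !hw ?andbF.
Qed.

End Stars.

(** The pairs [{p, m p}] partition [V] into blocks of size two, so there are [n] of them, and [rep]
    picks a point of each. *)
Lemma involution_transversal (V : finType) (m : V -> V) (n : nat) :
  involutive m -> (forall p, m p != p) -> #|V| = (2 * n)%N ->
  exists rep : 'I_n -> V, (forall p, exists i, p \in [set rep i; m (rep i)]) /\
    (forall i j, rep i \in [set rep j; m (rep j)] -> i = j).
Proof.
move=> mK mN cV.
pose D := [set [set p; m p] | p in [set: V]].
have memD p d : d \in D -> p \in d -> d = [set p; m p].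
  case/imsetP=> q _ ->; rewrite !inE => /orP[]/eqP-> //.
  by rewrite mK setUC.
have cD : #|D| = n.
  have /card_uniform_partition : {in D, forall d : {set V}, #|d| = 2%N}.
    by move=> d /imsetP[p _ ->]; rewrite cards2 eq_sym mN.
  move=> /(_ [set: V]); rewrite cardsT cV mulnC => h.
  apply/eqP; rewrite -(eqn_pmul2r (isT : (0 < 2)%N)) -h //.
  apply/and3P; split.
  - apply/eqP/setP => p; rewrite inE; apply/bigcupP.
    by exists [set p; m p]; [apply: imset_f | rewrite !inE eqxx].
  - apply/trivIsetP => d1 d2 h1 h2; apply: contraR => /pred0Pn[p /andP[/= p1
      p2]].
    by rewrite (memD p d1) // (memD p d2).
  - by apply/imsetP => -[p _ /setP/(_ p)]; rewrite !inE eqxx.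
have [f fP] : exists f : 'I_n -> V, forall i, enum_val (cast_ord (esym cD) i)
    = [set f i; m (f i)].
  apply: (fin_all_exists (P := fun i p => enum_val _ = [set p; m p])) => i.
  by have /imsetP[p _ ->] := enum_valP (cast_ord (esym cD) i); exists p.
exists f; split=> [p | i j].
  have pD : [set p; m p] \in D by apply: imset_f.
  exists (cast_ord cD (enum_rank_in pD [set p; m p])).
  by rewrite -fP cast_ordK enum_rankK_in // !inE eqxx.
rewrite -fP => /(memD _ _ (enum_valP _)); rewrite -fP.
by move=> /enum_val_inj /cast_ord_inj.
Qed.

(** * Combinatorics of mates and left sides: edge partition and successor *)

Section MatedPoints.
Variables (V : finType) (m : V -> V) (L : V -> {set V}).
Hypotheses (mK : involutive m) (mN : forall p, m p != p).
Hypotheses (LN : forall p, p \notin L p) (LmN : forall p, m p \notin L p).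
Hypothesis LK : forall p q, q != p -> q != m p -> (q \in L p) = (p \notin L q).
Hypothesis LC : forall p q, q != p -> q != m p -> (q \in L (m p)) = (q \notin
    L p).

Let L_neq p q : q \in L p -> q != p.
Proof. by move=> qp; apply: contraTneq qp => ->; apply: LN. Qed.

Let L_neqm p q : q \in L p -> q != m p.
Proof. by move=> qp; apply: contraTneq qp => ->; apply: LmN. Qed.

Let m_eq p q : (m p == q) = (p == m q).
Proof. by rewrite -(inj_eq (inv_inj mK)) mK. Qed.

(** Combinatorial form of the crossing of halving segments: [q] and its mate are separated by the
    halving line of [p]. *)
Lemma mem_mate p q : q != p -> q != m p -> (m q \in L p) = (q \notin L p).
Proof.
move=> qp qmp; rewrite (LK (q := m q)) ?m_eq ?mK //.
have -> : (p \in L (m q)) = (p \notin L q).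
  by apply: LC; rewrite eq_sym ?m_eq.
rewrite negbK.
by rewrite [q \in _]LK // negbK.
Qed.

(** The identity as [s] serves t = 0, the successor serves t = 1. *)
Definition tree (s : V -> V) p :=
  stars [set s p; s (m p)] p (m p) (L p) (L (m p)).

(** No star contains an edge [{u, m u}], and such an edge is central in exactly one tree because [s]
    permutes the mated pairs. Any other edge [{u, v}] belongs to the star of exactly one of its ends
    by [LK], hence to the tree of that end. *)
Lemma tree_partition (n : nat) (s : V -> V) (rep : 'I_n -> V) :
  injective s -> (forall p, s (m p) = m (s p)) ->
  (forall p, exists i, p \in [set rep i; m (rep i)]) ->
  (forall i j, rep i \in [set rep j; m (rep j)] -> i = j) ->
  edge_partition (fun i => tree s (rep i)).
Proof.
move=> sinj sm repP repI.
have repI2 i j p :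
    p \in [set rep i; m (rep i)] -> p \in [set rep j; m (rep j)] -> i = j.
  rewrite !inE => /orP[]/eqP-> h; apply: repI; rewrite !inE //.
  by move: h; rewrite m_eq (inj_eq (inv_inj mK)) orbC.
have [s' _ s'K] := injF_bij sinj.
have spair p w : (s w \in [set s p; s (m p)]) = (w \in [set p; m p]).
  by rewrite !inE !(inj_eq sinj).
have adjm p u : adj (tree s p) u (m u) = (u \in [set s p; s (m p)]).
  have mL w z : (m w == z) && (w \in L z) = false.
    by apply/negP => /andP[/eqP<-]; have := LmN (m w); rewrite mK => /negPf->.
  have mL' w z : (w == z) && (m w \in L z) = false.
    by apply/negP => /andP[/eqP<-]; apply/negP.
  rewrite adj_stars !mL !mL' /= !orbF eq_set2 !inE sm.
  by rewrite (inj_eq (inv_inj mK)) m_eq !andbb.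
have adjL p u v : v != m u -> adj (tree s p) u v =
    (u \in [set p; m p]) && (v \in L u) || (v \in [set p; m p]) && (u \in L v).
  move=> vu; rewrite adj_stars !inE eq_set2 !sm.
  have -> : (u == s p) && (v == m (s p)) || (u == m (s p)) && (v == s p) =
      false.
    by apply/negP => /orP[]/andP[/eqP e1 /eqP e2]; move: vu;
        rewrite e1 e2 ?mK eqxx.
  rewrite /= !andb_orl.
  have sub w z x : (w == z) && (x \in L z) = (w == z) && (x \in L w).
    by case: eqVneq => // ->.
  rewrite !(sub u) !(sub v).
  by case: (u == p); case: (u == m p); case: (v == p); case: (v == m p);
      case: (v \in L u); case: (u \in L v).
have Lx u v : v != u -> v != m u -> (u \in L v) = (v \notin L u).
  by move=> uv umv; rewrite (LK uv umv) negbK.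
have treeC p : tree s p \subset complete_edges V.
  apply: stars_sub => //.
  by rewrite cards2 (inj_eq sinj) eq_sym mN.
split.
  move=> i j; apply: contraNT => /pred0Pn[e /andP[/= ei ej]]; apply/eqP.
  have := subsetP (treeC _) _ ei; rewrite in_set => /cards2P[u [v [uv eE]]];
      rewrite eE in ei ej.
  rewrite -[_ \in _]/(adj _ u v) in ei; rewrite -[_ \in _]/(adj _ u v) in ej.
  have [vu|vu] := eqVneq v (m u).
    by move: ei ej; rewrite vu !adjm -(s'K u) !spair; apply: repI2.
  move: ei ej; rewrite !adjL // (_ : (u \in L v) = (v \notin L u));
      last by rewrite Lx // eq_sym.
  case: (v \in L u); rewrite ?andbT ?andbF ?orbF /=; exact: repI2.
apply/setP => e; apply/bigcupP/idP => [[i _] /(subsetP (treeC _))//|].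
rewrite inE => /cards2P[u [v [uv ->]]].
have [vu|vu] := eqVneq v (m u).
  have [i wi] := repP (s' u); exists i => //.
  by rewrite -[_ \in _]/(adj _ u v) vu adjm -(s'K u) spair.
have [i ui] := repP u; have [j vj] := repP v.
have [vLu|vLu] := boolP (v \in L u).
  by exists i => //; rewrite -[_ \in _]/(adj _ u v) adjL // ui vLu.
exists j => //; rewrite -[_ \in _]/(adj _ u v) adjL // vj (_ : u \in L v)
    ?orbT //.
by rewrite Lx // eq_sym.
Qed.

Section Successor.
Variable s : V -> V.
Hypothesis sL : forall p, s p \in L (m p).
Hypothesis sP : forall p z, z \in L (m p) -> z != s p -> z \in L (m (s p)).

Lemma succ_mate p : s (m p) = m (s p).
Proof.
have mLm q z : z \in L q -> m z \in L (m q).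
  move=> zq; have zq1 := L_neq zq; have zq2 := L_neqm zq.
  by rewrite mem_mate ?mK // LC // negbK.
apply/eqP; rewrite -m_eq; apply/negPn/negP => ne.
have y1 := mLm _ _ (sL (m p)); rewrite mK in y1.
have y2 := sP y1 ne.
have x1 := mLm _ _ (sL p).
have x2 : m (s p) \in L (m (s (m p))) by apply: sP => //; rewrite m_eq eq_sym.
have sE : s p != s (m p).
  apply: contraTneq (sL p) => ->; rewrite LC ?negbK.
  - by have := sL (m p); rewrite mK.
  - by have := L_neq (sL (m p)); rewrite mK.
  - by have := L_neqm (sL (m p)); rewrite mK.
have := LK (p := m (s p)) (q := m (s (m p))).
by rewrite y2 x2 mK (inj_eq (inv_inj mK)) eq_sym sE => /(_ isT ne).
Qed.

(** If distinct [p] and [q] shared a successor, [key] applied both ways would put each outside the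
    [L] of the other, contrary to [LK]. The case [q = m p] is separate: the successors then lie on
    opposite sides of one halving line. *)
Lemma succ_inj : injective s.
Proof.
move=> p q spq; apply/eqP/negPn/negP => pq.
(* From [s x \in L (m y)] it follows that [y] is outside [L (m (s x))], so [sP] keeps it outside
   [L (m x)]. *)
have key x y : s x = s y -> x != y -> y != m x -> m x \in L y.
  move=> sxy xy ymx; have sy := sL y; rewrite -sxy in sy.
  have wy := L_neqm sy; have wmy := L_neq sy; rewrite mK in wy.
  have : m y \notin L (s x) by rewrite -LK ?mK.
  have h1 : m y != s x by rewrite eq_sym.
  have h2 : y != s x by rewrite eq_sym.
  rewrite -LC ?(inj_eq (inv_inj mK)) // (mem_mate (p := m (s x)) (q := y)) ?mK
      -?m_eq // => yL.
  have : y \notin L (m x) by apply: contra yL => /sP; apply; rewrite eq_sym.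
  by rewrite (LK (q := y)) ?negbK // mK eq_sym.
have qp : q != m p.
  have sp := sL p; have := L_neq sp; have := L_neqm sp; rewrite mK => s1 s2.
  have sq := sL q; rewrite -spq in sq; apply: contraTneq sq => ->; rewrite mK.
  by rewrite LC in sp.
have pmq : p != m q by rewrite -m_eq eq_sym.
have qp' : q != p by rewrite eq_sym.
have := key q p (esym spq) qp' pmq; rewrite mem_mate //.
have := key p q spq pq qp; rewrite mem_mate //.
by rewrite (LK (q := q)) // negbK => /negPf ->.
Qed.

End Successor.
End MatedPoints.

(** * Orientation, segments and cotangents *)

Section Plane.
Variable R : realType.
Implicit Types a b d p q r u v w x y z : 'rV[R]_2.

Lemma orient_swap p q r : orient q p r = - orient p q r.
Proof. by rewrite /orient; ring. Qed.

Lemma orient_rot p q r : orient q r p = orient p q r.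
Proof. by rewrite /orient; ring. Qed.

Lemma orient_affine p q r u (t : R) :
  orient p q ((1 - t) *: r + t *: u) =
  (1 - t) * orient p q r + t * orient p q u.
Proof. by rewrite /orient !mxE; ring. Qed.

Lemma orient_l p q : orient p q p = 0.
Proof. by rewrite /orient; ring. Qed.

Lemma orient_r p q : orient p q q = 0.
Proof. by rewrite /orient; ring. Qed.

Lemma line_sym p q : line p q = line q p.
Proof.
by apply/seteqP; split=> x; rewrite /line /= orient_swap => /eqP;
  rewrite oppr_eq0 => /eqP.
Qed.

Lemma segment_sym p q x : segment p q x -> segment q p x.
Proof.
move=> [t t01 ->]; exists (1 - t); first by lra.
by rewrite addrC; congr (_ *: _ + _ *: _); ring.
Qed.

Lemma segment_common_end a z w x : orient a z w != 0 ->
  segment a z x -> segment a w x -> x = a.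
Proof.
move=> azw [t _ xt] [r _ xr].
have : orient a z x = 0 by rewrite xt orient_affine orient_l orient_r; ring.
rewrite xr orient_affine orient_l mulr0 add0r => /eqP.
rewrite mulf_eq0 (negPf azw) orbF => /eqP ->.
by rewrite subr0 scale1r scale0r addr0.
Qed.

Lemma segment_sides a b z w x :
  a != b -> 0 < orient a b z -> 0 < orient b a w ->
  segment a z x -> segment b w x -> False.
Proof.
move=> ab abz; rewrite orient_swap => abw [t t01 xt] [r r01 xr].
have : t * orient a b z = r * orient a b w.
  by move: xr; rewrite xt => /(congr1 (orient a b));
      rewrite !orient_affine orient_l orient_r; lra.
(* The two sides of [e] have opposite signs, so both vanish and the common point is [a] as well as
   [b]. *)
move=> e; have t0 : t = 0 by nra.
have r0 : r = 0 by nra.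
rewrite t0 subr0 scale1r scale0r addr0 in xt.
rewrite r0 subr0 scale1r scale0r addr0 in xr.
by rewrite -xt -xr eqxx in ab.
Qed.

Lemma segment_line_side x y a z u : 0 < orient y x a -> 0 < orient y x z ->
  segment x y u -> segment a z u -> False.
Proof.
move=> xa xz [t t01 ut] [r r01 ur].
have : orient y x u = 0 by rewrite ut orient_affine orient_l orient_r; ring.
by rewrite ur orient_affine; nra.
Qed.

(* Cotangent of the angle from [d] to [u], set to [0] by division by [0] when
   [u] is parallel to [d]. *)
Definition cot d u : R :=
  (d 0 0 * u 0 0 + d 0 1 * u 0 1) / (d 0 0 * u 0 1 - d 0 1 * u 0 0).

(** Translates the order of cotangents into orientation: the sign of the cross product of [u] and
    [v] is read off from their sides of [d] and the difference of their cotangents. *)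
Lemma cotB d u v :
  d 0 0 * u 0 1 - d 0 1 * u 0 0 != 0 -> d 0 0 * v 0 1 - d 0 1 * v 0 0 != 0 ->
  (u 0 0 * v 0 1 - u 0 1 * v 0 0) * (d 0 0 ^+ 2 + d 0 1 ^+ 2) =
  (d 0 0 * u 0 1 - d 0 1 * u 0 0) * (d 0 0 * v 0 1 - d 0 1 * v 0 0)
  * (cot d u - cot d v).
Proof. by move=> du dv; rewrite /cot; field; rewrite du dv. Qed.

End Plane.

Lemma card_fset_sub (K : choiceType) (A : {fset K}) (Q : pred K) :
  #|` [fset x in A | Q x]|%fset = #|[set x : A | Q (val x)]|.
Proof.
have -> : [fset x in A | Q x]%fset =
    [fset val x | x in [set x : A | Q (val x)]]%fset.
  apply/fsetP => x; rewrite !inE /=; apply/andP/imfsetP => /= [[xA Qx]|[y yA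
      ->]].
    by exists [` xA]%fset; rewrite ?inE.
  by rewrite inE in yA; split=> //; apply: valP.
by rewrite card_imfset /= -?cardE //; apply: val_inj.
Qed.

Lemma orient_flip (R : realType) (p q r : 'rV[R]_2) :
  orient p r q = - orient p q r.
Proof. by rewrite /orient; ring. Qed.

(** * Points to the left of a line rotating about a point of [P] *)

Section Configuration.
Variables (R : realType) (P : {fset 'rV[R]_2}).
Implicit Types p q r z : P.

Definition left_of p q : {set P} :=
  [set r : P | 0 < orient (val p) (val q) (val r)].

Hypothesis gen : general_position P.

Lemma orient_neq0 p q r : p != q -> p != r -> q != r ->
  orient (val p) (val q) (val r) != 0.
Proof.
move=> pq pr qr; apply/eqP.
by apply: (gen (valP p) (valP q) (valP r)); rewrite val_eqE.
Qed.

Lemma left_of_start p q : p \notin left_of p q.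
Proof. by rewrite inE orient_l ltxx. Qed.

Lemma left_of_end p q : q \notin left_of p q.
Proof. by rewrite inE orient_r ltxx. Qed.

Lemma left_of_rev p q r : p != q -> r != p -> r != q ->
  (r \in left_of q p) = (r \notin left_of p q).
Proof.
move=> pq rp rq; rewrite !inE orient_swap oppr_gt0 -leNgt le_eqVlt.
by rewrite (negPf (orient_neq0 pq _ _)) // eq_sym.
Qed.

Lemma card_left_of p q : p != q ->
  (#|left_of p q| + #|left_of q p| = #|{: P}| - 2)%N.
Proof.
move=> pq; have -> : left_of q p = ~: (left_of p q :|: [set p; q]).
  apply/setP => r; rewrite in_setC in_setU in_set2 negb_or.
  have [->|rp] := eqVneq r p; first by rewrite (negPf (left_of_end _ _)) andbF.
  have [->|rq] := eqVneq r q; first by rewrite (negPf (left_of_start _ _))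
      andbF.
  by rewrite left_of_rev // andbT.
rewrite -(cardsC (left_of p q :|: [set p; q])).
suff -> : #|left_of p q :|: [set p; q]| = (#|left_of p q| + 2)%N by lia.
rewrite cardsU cards2 pq (_ : left_of p q :&: _ = set0) ?cards0 ?subn0 //.
apply/setP => r; rewrite !in_setI in_set2 in_set0.
by apply/negP => /andP[h /orP[]/eqP e]; move: h;
    rewrite e ?(negPf (left_of_start _ _)) ?(negPf (left_of_end _ _)).
Qed.

(** Application of [sweep_card_lt] at the pivot [p], with the direction from [p] to [m] as
    horizontal axis. A line through [p] and [x] is directed from [p] to [x] or from [x] to [p],
    whichever points upwards. *)
Lemma card_left_of_sweep (N : nat) p m : p != m -> #|left_of p m| = N ->
  (forall q, q != p -> q != m -> #|left_of p q| <> N) ->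
  (forall q, q != p -> q != m -> #|left_of q p| <> N) ->
  forall q, (q \in left_of p m -> (#|left_of p q| < N)%N) /\
            (q \in left_of m p -> (#|left_of q p| < N)%N).
Proof.
move=> pm cN neN neN'.
pose d := val m - val p.
pose A := [set y | (y != p) && (y != m)].
pose k (y : P) := cot d (val y - val p).
pose s y := y \in left_of p m.
have d0 : 0 < d 0 0 ^+ 2 + d 0 1 ^+ 2.
  rewrite lt_neqAle addr_ge0 ?sqr_ge0 // andbT eq_sym paddr_eq0 ?sqr_ge0 //
      !sqrf_eq0.
  apply: contra pm => /andP[/eqP d1 /eqP d2]; rewrite eq_sym -val_eqE -subr_eq0.
  apply/eqP/rowP => i; rewrite [RHS]mxE -/d.
  by case: i => [[|[|i]] hi] //; [rewrite -[RHS]d1|rewrite -[RHS]d2];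
      congr (d _ _); apply: val_inj.
have oE (y : P) : orient (val p) (val m) (val y) =
    d 0 0 * (val y - val p) 0 1 - d 0 1 * (val y - val p) 0 0.
  by rewrite /orient /d !mxE.
have oA y : y \in A -> orient (val p) (val m) (val y) != 0.
  by rewrite inE => /andP[yp ym]; rewrite orient_neq0 // eq_sym.
have kE x y : x \in A -> y \in A ->
   orient (val p) (val x) (val y) * (d 0 0 ^+ 2 + d 0 1 ^+ 2) =
   orient (val p) (val m) (val x) * orient (val p) (val m) (val y)
   * (k x - k y).
  by move=> /oA + /oA; rewrite !oE => hx hy; rewrite -cotB // /orient !mxE.
have sE y : s y = (0 < orient (val p) (val m) (val y)) by rewrite /s inE.
have sN y : y \in A -> ~~ s y = (orient (val p) (val m) (val y) < 0).
  by move=> /oA; rewrite sE -leNgt le_eqVlt => /negPf ->.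
have kinj : {in A &, injective k}.
  move=> x y xA yA kxy; apply/eqP/negPn/negP => xy.
  have := kE _ _ xA yA; rewrite kxy subrr mulr0 => /eqP.
  rewrite mulf_eq0 (gt_eqF d0) orbF; apply/negP.
  by move: xA yA; rewrite !inE => /andP[xp _] /andP[yp _];
      rewrite orient_neq0 // eq_sym.
have lA x : x \in A -> (if s x then left_of p x else left_of x p) =
   [set y in A | s y & (k y < k x)%R] :|: [set y in A | ~~ s y & (k x < k y)%R].
  move=> xA; apply/setP => y; rewrite in_setU !(in_set (fun y =>
      (y \in A) && _)).
  have [yA|] := boolP (y \in A); last first.
    rewrite inE negb_and !negbK => ypm /=.
    have sx := sE x; have sxN := sN _ xA.
    (* The points outside [A] must not be counted: [p] is on the line, and [m] is to the right of an
       upward directed line. *)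
    move: ypm => /orP[]/eqP->; case: ifP => hx; rewrite hx in sx sxN.
    + by rewrite (negPf (left_of_start _ _)).
    + by rewrite (negPf (left_of_end _ _)).
    + by rewrite inE orient_flip; apply/negbTE; rewrite -leNgt; lra.
    + by rewrite inE -orient_rot; apply/negbTE; rewrite -leNgt; lra.
  have := kE _ _ xA yA.
  case: ifP => [|/negbT] sx; case: (boolP (s y)) => sy /=; rewrite ?orbF inE.
  - rewrite sE in sx; rewrite sE in sy => e.
    by rewrite -(pmulr_lgt0 _ d0) e pmulr_rgt0 ?subr_gt0 ?mulr_gt0.
  - rewrite sE in sx; rewrite sN // in sy => e.
    by rewrite -(pmulr_lgt0 _ d0) e nmulr_rgt0 ?subr_lt0 ?pmulr_rlt0.
  - rewrite sN // in sx; rewrite sE in sy => e.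
    by rewrite orient_swap oppr_gt0 -(pmulr_llt0 _ d0) e nmulr_rlt0 ?subr_gt0
        ?nmulr_rlt0.
  - rewrite sN // in sx; rewrite sN // in sy => e.
    by rewrite orient_swap oppr_gt0 -(pmulr_llt0 _ d0) e pmulr_rlt0 ?subr_lt0
        ?nmulr_rgt0.
have lcard x : x \in A -> #|if s x then left_of p x else left_of x p| =
   (#|[set y in A | s y & (k y < k x)%R]|
    + #|[set y in A | ~~ s y & (k x < k y)%R]|)%N.
  move=> xA; rewrite lA // cardsU (_ : _ :&: _ = set0) ?cards0 ?subn0 //.
  apply/setP => y; rewrite in_setI !(in_set (fun y => (y \in A) && _)) in_set0.
  by case: (s y); rewrite /= ?andbF.
have sl : [set y in A | s y] = left_of p m.
  apply/setP => y; rewrite in_set andb_idl //.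
  move=> ym; rewrite inE; apply/andP; split; apply: contraTneq ym => ->;
      [exact: left_of_start | exact: left_of_end].
have := sweep_card_lt kinj (N := N) (s := s); rewrite sl cN =>
    /(_ (leqnn _)) key.
have {key} lt x : x \in A ->
    (#|if s x then left_of p x else left_of x p| < N)%N.
  move=> xA; rewrite lcard //; apply: key xA => z zA; rewrite -lcard //.
  by move: zA; rewrite inE => /andP[zp zm]; case: ifP => _;
      [apply: neN | apply: neN'].
move=> q; split=> qm.
  have qA : q \in A by move: qm; rewrite -sl in_set => /andP[].
  by have := lt q qA; rewrite /s qm.
have qA : q \in A.
  rewrite inE; apply/andP; split; apply: contraTneq qm => ->;
      [exact: left_of_end | exact: left_of_start].
have := lt q qA; rewrite ifN // /s -left_of_rev //; by move: qA;
    rewrite inE => /andP[].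
Qed.

End Configuration.

(** * Planarity of two stars with a further edge *)

Section PlaneStars.
Variables (R : realType) (P : {fset 'rV[R]_2}).
Hypothesis gen : general_position P.
Implicit Types (a b c u v w z : P) (e : {set P}).

Definition on_edge e (x : 'rV[R]_2) : Prop :=
  exists u v, e = [set u; v] /\ segment (val u) (val v) x.

Definition meet_at_ends e1 e2 : Prop :=
  forall x, on_edge e1 x -> on_edge e2 x ->
  exists2 y : P, y \in e1 :&: e2 & x = val y.

Lemma on_edgeP u v x : on_edge [set u; v] x -> segment (val u) (val v) x.
Proof.
move=> [w [z [/eqP + wz]]]; rewrite eq_set2.
by case/orP=> /andP[/eqP-> /eqP->] //; apply: segment_sym.
Qed.

Lemma meet_at_ends_sym e1 e2 : meet_at_ends e1 e2 -> meet_at_ends e2 e1.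
Proof. by move=> h x x1 x2; rewrite setIC; apply: h. Qed.

Lemma meet_common_end c z w : c != z -> c != w -> z != w ->
  meet_at_ends [set c; z] [set c; w].
Proof.
move=> cz cw zw x /on_edgeP xz /on_edgeP xw; exists c;
    first by rewrite !inE eqxx.
exact: segment_common_end (orient_neq0 gen cz cw zw) xz xw.
Qed.

(** Edges of one star meet only at its centre by general position, and the two stars lie on opposite
    sides of the line [a b]. Only [e] remains to be compared with the star edges. *)
Lemma plane_stars e a b : a != b ->
  {in left_of a b, forall z, e != [set a; z] -> meet_at_ends e [set a; z]} ->
  {in left_of b a, forall w, e != [set b; w] -> meet_at_ends e [set b; w]} ->
  plane (stars e a b (left_of a b) (left_of b a)).
Proof.
move=> ab ea eb.
have lneq c d z : z \in left_of c d -> c != z.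
  by apply: contraTneq => <-; apply: left_of_start.
have same c d z w : z \in left_of c d -> w \in left_of c d ->
    [set c; z] != [set c; w] ->
    meet_at_ends [set c; z] [set c; w].
  move=> /lneq cz /lneq cw zw; apply: meet_common_end => //.
  by apply: contraNneq zw => ->.
have opp z w : z \in left_of a b -> w \in left_of b a ->
    meet_at_ends [set a; z] [set b; w].
  rewrite !inE => za wb x /on_edgeP xz /on_edgeP xw.
  by case: (segment_sides _ za wb xz xw); rewrite val_eqE.
suff key e1 e2 : e1 \in stars e a b (left_of a b) (left_of b a) ->
    e2 \in stars e a b (left_of a b) (left_of b a) -> e1 != e2 ->
    meet_at_ends e1 e2.
  move=> u v w z h1 h2 ne x xuv xwz; apply: (key _ _ h1 h2 ne x).
    by exists u, v.
  by exists w, z.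
rewrite !inE => /or3P[/eqP->|/imsetP[z za ->]|/imsetP[z zb ->]]
  /or3P[/eqP->|/imsetP[w wa ->]|/imsetP[w wb ->]] ne.
- by rewrite eqxx in ne.
- exact: ea.
- exact: eb.
- by apply/meet_at_ends_sym/ea; rewrite 1?eq_sym.
- exact: same za wa ne.
- exact: opp.
- by apply/meet_at_ends_sym/eb; rewrite 1?eq_sym.
- by apply/meet_at_ends_sym/opp.
- exact: same zb wb ne.
Qed.

Lemma plane_stars0 a b : a != b ->
  plane (stars [set a; b] a b (left_of a b) (left_of b a)).
Proof.
move=> ab; apply: plane_stars => // z zl ne; last rewrite setUC in ne *;
  by apply: meet_common_end; rewrite // 1?eq_sym //;
     apply: contraTneq zl => ->; rewrite ?left_of_start ?left_of_end.
Qed.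

(** The line [x y] separates the star edges at [a] other than [a x] from those at [b] other than
    [b y], so these avoid the segment [x y]; the two exceptions share an endpoint with it. *)
Lemma plane_stars2 a b x y : a != b -> x \in left_of a b -> y \in left_of b a ->
  a \in left_of y x -> b \in left_of x y ->
  {in left_of a b, forall z, z != x -> z \in left_of y x} ->
  {in left_of b a, forall w, w != y -> w \in left_of x y} ->
  plane (stars [set x; y] a b (left_of a b) (left_of b a)).
Proof.
move=> ab xl yl al bl hz hw.
have side u v c z : c != u -> c != v -> u != v -> c \in left_of v u ->
    (z != u -> z \in left_of v u) -> meet_at_ends [set u; v] [set c; z].
  move=> cu cv uv cl; have [-> _|_ /(_ isT) zl] := eqVneq z u.
    by rewrite [[set c; u]]setUC; apply: meet_common_end; rewrite // eq_sym.
  move=> t /on_edgeP tuv /on_edgeP tcz; exfalso.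
  by rewrite !inE in cl zl; apply: segment_line_side cl zl tuv tcz.
have xy : x != y.
  apply: contraTneq xl => ->; apply/negP; move: yl; rewrite !inE orient_swap;
      lra.
have lneq c u v : c \in left_of u v -> (c != u) * (c != v).
  by move=> h; split; apply: contraTneq h => ->;
      rewrite ?left_of_start ?left_of_end.
apply: plane_stars => // z zl ne.
  by apply: side; rewrite ?(lneq _ _ _ al) //; apply: hz.
rewrite setUC.
by apply: side; rewrite ?(lneq _ _ _ bl) // ?[y == x]eq_sym //; apply: hw.
Qed.

End PlaneStars.

(** * The mate of a point on its halving line *)

Section HalvingMates.
Variables (R : realType) (n : nat) (P : {fset 'rV[R]_2}).
Hypotheses (hcard : #|` P|%fset = (2 * n)%N) (gen : general_position P).
Hypothesis hhalv : forall p : 'rV[R]_2, p \in P ->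
       exists! L : set 'rV[R]_2, halving_line n P L /\ L p.
Implicit Types p q x z : P.

Lemma card_points : #|{: P}| = (2 * n)%N.
Proof. by rewrite -cardfE. Qed.

Lemma halving_mates : exists m : P -> P, forall p,
  [/\ p != m p, #|left_of p (m p)| = (n - 1)%N &
      forall q, p != q -> #|left_of p q| = (n - 1)%N -> q = m p].
Proof.
have lcard p q : #|` [fset x in P | 0 < orient (val p) (val q) x]|%fset =
    #|left_of p q|.
  by rewrite card_fset_sub.
have rcard p q : #|` [fset x in P | orient (val p) (val q) x < 0]|%fset =
    #|left_of q p|.
  by rewrite card_fset_sub; apply: eq_card => x;
      rewrite !inE orient_swap oppr_lt0.
apply: (fin_all_exists (P := fun p m => [/\ p != m, #|left_of p m| = (n - 1)%N &
  forall q, p != q -> #|left_of p q| = (n - 1)%N -> q = m])) => p.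
have [L [[hL Lp] uL]] := hhalv (valP p).
have [m [pm Lm cm]] : exists m, [/\ p != m, L = line (val p) (val m) &
    #|left_of p m| = (n - 1)%N].
  move: hL => [u [v [[uP vP uv eL] []]]].
  rewrite -[u]/(val [` uP]%fset) -[v]/(val [` vP]%fset) lcard rcard => c1 c2.
  set u' := [` uP]%fset in c1 c2; set v' := [` vP]%fset in c1 c2.
  have uv' : u' != v' by rewrite -val_eqE.
  have [e|pu] := eqVneq p u'; first by exists v'; rewrite e.
  have [e|pv] := eqVneq p v'.
    by exists u'; rewrite e eq_sym uv' line_sym.
  (* A halving line through [p] must have [p] among its two defining points, else three points of
     [P] would be collinear. *)
  have := orient_neq0 gen uv' (r := p); rewrite ![_ == p]eq_sym => /(_ pu pv).
  by move: Lp; rewrite eL /line /= => ->; rewrite eqxx.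
exists m; split=> // q pq cq; apply/eqP/negPn/negP => qm.
(* With [n - 1] of the remaining [2n - 2] points on the left, [n - 1] are on the right too, so this
   line is halving and equals [L]; then [p], [m] and [q] are collinear. *)
have : L = line (val p) (val q).
  apply: uL; split; last exact: orient_l.
  exists (val p), (val q); rewrite lcard rcard cq; split.
    by split; rewrite ?val_eqE //; apply: valP.
  by split=> //; have := card_left_of gen pq; rewrite cq card_points; lia.
rewrite Lm => e; have : line (val p) (val m) (val q) by rewrite e;
    apply: orient_r.
apply/eqP/orient_neq0 => //; by rewrite eq_sym.
Qed.

End HalvingMates.

(** * The next halving line in the order of slopes *)

Section Successors.
Variables (R : realType) (P : {fset 'rV[R]_2}) (m : P -> P).
Hypothesis gen : general_position P.
Hypotheses (mK : involutive m) (mN : forall p, m p != p).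
Let L p := left_of p (m p).
Hypothesis LK : forall p q, q != p -> q != m p -> (q \in L p) = (p \notin L q).
Hypothesis Lgt0 : forall p, (0 < #|L p|)%N.

(* For [x] and [z] in [L (m p)], [z] is in [L (m x)] when the halving line through
   [z] has a larger angle with the one through [p] than the halving line through
   [x] has, so [s p] is the point [x] of largest cotangent. *)
Lemma first_successor : exists s : P -> P, forall p,
  s p \in L (m p) /\ forall z, z \in L (m p) -> z != s p -> z \in L (m (s p)).
Proof.
have LN p : p \notin L p by apply: left_of_start.
have LmN p : m p \notin L p by apply: left_of_end.
have LC p q : q != p -> q != m p -> (q \in L (m p)) = (q \notin L p).
  by move=> qp qmp; rewrite /L mK left_of_rev // eq_sym mN.
have mL := mem_mate mK LK LC.
pose d p := val p - val (m p).
(* Since [z] is to the left of the line from [m p] to [p] and [m z] is not, the vector from [m z] to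
   [z] turns left from [d p]. *)
have dgt0 p z : z \in L (m p) -> 0 < d p 0 0 * d z 0 1 - d p 0 1 * d z 0 0.
  move=> zL; have : m z \notin L (m p).
    rewrite mL ?negbK ?mK //; apply: contraTneq zL => ->; first exact: LN.
    by rewrite -{1}[p]mK LmN.
  move: zL; rewrite /L mK !inE /d !mxE /orient; lra.
apply: (fin_all_exists (P := fun p x => x \in L (m p) /\
  forall z, z \in L (m p) -> z != x -> z \in L (m x))) => p.
have /card_gt0P[x0 x0L] := Lgt0 (m p).
case: (@Order.TotalTheory.arg_maxP _ _ _ x0 (fun x => x \in L (m p))
         (fun x => cot (d p) (d x)) x0L) => x xL xmax.
exists x; split=> // z zL zx; apply/negPn/negP => zN.
have zmx : x != m z.
  apply: contraTneq xL => ->; rewrite mL ?negbK ?mK //;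
      apply: contraTneq zL => ->; first exact: LN.
  by rewrite -{1}[p]mK LmN.
have xz : x != z by rewrite eq_sym.
have zxm : z != m x by rewrite -(inj_eq (inv_inj mK)) mK eq_sym.
(* If [z] is outside [L (m x)], then [x] is in [L (m z)]; so [d x] turns left from [d z], and [cotB]
   gives [z] a larger cotangent than the maximum. *)
rewrite LC // negbK in zN.
have : x \in L (m z) by rewrite LC // -(LK (p := x) (q := z)).
move=> /dgt0 zxd; have zd := dgt0 _ _ zL; have xd := dgt0 _ _ xL.
have := cotB (lt0r_neq0 zd) (lt0r_neq0 xd).
have cle : cot (d p) (d z) <= cot (d p) (d x) := xmax z zL.
move=> e.
have : 0 < d p 0 0 ^+ 2 + d p 0 1 ^+ 2.
  rewrite lt_neqAle addr_ge0 ?sqr_ge0 // andbT eq_sym paddr_eq0 ?sqr_ge0 //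
      !sqrf_eq0.
  by apply/negP => /andP[/eqP d1 /eqP d2]; move: zd; rewrite d1 d2; lra.
move=> d0.
have := mulr_gt0 zxd d0; rewrite e.
by rewrite pmulr_rgt0 ?mulr_gt0 // subr_gt0 ltNge cle.
Qed.

End Successors.

(** * Assembly of the trees for both values of t *)

Theorem theorem2 (R : realType) (n : nat) (P : {fset 'rV[R]_2})
    (hn : (2 <= n)%N) (hcard : #|` P|%fset = (2 * n)%N)
    (hgen : general_position P)
    (hhalv : forall p : 'rV[R]_2, p \in P ->
       exists! L : set 'rV[R]_2, halving_line n P L /\ L p) :
  forall t : nat, (t = 0 \/ t = 1)%N ->
  exists T : 'I_n -> {set {set P}},
    edge_partition T /\
    forall i : 'I_n,
      [/\ spanning_tree (T i), plane (T i) &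
          graph_iso (adj (T i)) (@dstar_rel (2 * t) (n - t) (n - t))].
Proof.
move=> t tE.
have cP := card_points hcard.
have [m mP] := halving_mates hcard hgen hhalv.
have mN (p : P) : m p != p by have [+ _ _] := mP p; rewrite eq_sym.
have cL (p : P) : #|left_of p (m p)| = (n - 1)%N by case: (mP p).
have mU (p q : P) : p != q -> #|left_of p q| = (n - 1)%N -> q = m p.
  by case: (mP p) => _ _; apply.
have cR (p : P) : #|left_of (m p) p| = (n - 1)%N.
  have := card_left_of hgen (mN p); rewrite cL cP; lia.
have mK : involutive m by move=> p; apply/esym/mU.
pose L (p : P) := left_of p (m p).
have cD (p q : P) : p != q -> (#|left_of p q| + #|left_of q p| = 2 * (n - 1))%N.
  by move=> pq; rewrite (card_left_of hgen) // cP; lia.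
have sw (p q : P) : (q \in L p -> (#|left_of p q| < n - 1)%N) /\
              (q \in left_of (m p) p -> (#|left_of q p| < n - 1)%N).
  apply: (card_left_of_sweep hgen) => [|//|r rp rm c|r rp rm c];
      first by rewrite eq_sym.
    by move: rm; rewrite (mU p r) ?eqxx // eq_sym.
  by rewrite (mU _ _ rp c) mK eqxx in rm.
(* If both or neither of [q \in L p] and [p \in L q] held, [sw] would make both sides of the line
   [p q] smaller than [n - 1], although by [cD] they add up to [2 * (n - 1)]. *)
have LK p q : q != p -> q != m p -> (q \in L p) = (p \notin L q).
  move=> qp qmp; have pq : p != q by rewrite eq_sym.
  have pmq : p != m q by rewrite -(inj_eq (inv_inj mK)) mK eq_sym.
  have [sp1 sp2] := sw p q; have [sq1 sq2] := sw q p.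
  have := cD _ _ pq; move: sp2 sq2.
  rewrite (left_of_rev hgen (p := p) (q := m p)) // 1?eq_sym // -/(L p).
  rewrite (left_of_rev hgen (p := q) (q := m q)) // 1?eq_sym // -/(L q).
  move: sp1 sq1; case: (q \in L p); case: (p \in L q) => //=.
    by move=> /(_ isT) + /(_ isT); lia.
  by move=> _ _ /(_ isT) + /(_ isT); lia.
have LN p : p \notin L p by apply: left_of_start.
have LmN p : m p \notin L p by apply: left_of_end.
have LC p q : q != p -> q != m p -> (q \in L (m p)) = (q \notin L p).
  by move=> qp qmp; rewrite /L mK left_of_rev // eq_sym mN.
have dis p : [disjoint L p & L (m p)].
  apply/pred0P => z /=; apply/negbTE/andP => -[zp]; rewrite LC ?zp //.
    by apply: contraTneq zp => ->.
  by apply: contraTneq zp => ->.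
have Lm p : L (m p) = left_of (m p) p by rewrite /L mK.
have pLm p : p \notin L (m p) by rewrite Lm left_of_end.
have mpLm p : m p \notin L (m p) by rewrite Lm left_of_start.
have [rep [repP repI]] := involution_transversal mK mN cP.
have pm p : p != m p by rewrite eq_sym.
have n0 : (0 < n)%N by lia.
have cLp p : #|L p| = (n - 1)%N by apply: cL.
have cLm p : #|L (m p)| = (n - 1)%N by rewrite Lm.
have sub s p : injective s -> tree m L s p \subset complete_edges P.
  move=> sinj; apply: stars_sub => //.
  by rewrite cards2 (inj_eq sinj) pm.
case: tE => ->.
  exists (fun i => tree m L id (rep i)); split; first exact: tree_partition.
  move=> i; rewrite muln0 subn0.
  have iso : graph_iso (adj (tree m L id (rep i))) (@dstar_rel 0 n n).
    by apply: stars_iso0.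
  split=> //; first exact: dstar_iso_tree (sub _ _ _) iso.
  by rewrite /tree Lm; apply: plane_stars0.
(* Here [n >= 2] enters: a successor needs a nonempty left side to be chosen from. *)
have Lgt0 p : (0 < #|L p|)%N by rewrite cL; lia.
have [s sP] := first_successor hgen mK mN LK Lgt0.
have sL p : s p \in L (m p) by case: (sP p).
have sF p z : z \in L (m p) -> z != s p -> z \in L (m (s p)).
  by case: (sP p) => _; apply.
have sm := succ_mate mK LN LmN LK LC sL sF.
have sinj := succ_inj mK LN LmN LK LC sL sF.
exists (fun i => tree m L s (rep i)); split; first exact: tree_partition.
move=> i; rewrite muln1; set p := rep i.
have smL : s (m p) \in L p by have := sL (m p); rewrite mK.
have treeE : tree m L s p = stars [set s (m p); s p] p (m p) (L p) (L (m p)).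
  by rewrite /tree setUC.
have iso : graph_iso (adj (tree m L s p)) (@dstar_rel 2 (n - 1) (n - 1)).
  by rewrite treeE; apply: stars_iso2.
split=> //; first exact: dstar_iso_tree (sub _ _ _) iso.
(* Taken at [p] and at [m p], this puts the two centres on opposite sides of the new central edge;
   [sF] does the same for the leaves. *)
have mem_succ q : q \in left_of (s q) (s (m q)).
  have sq := sL q.
  have s1 : s q != q by apply: contraTneq sq => ->.
  have s2 : s q != m q by apply: contraTneq sq => ->.
  by rewrite sm -/(L (s q)) -[_ \in _]negbK -LK // -LC.
rewrite treeE Lm; apply: plane_stars2 => //.
- by rewrite -Lm.
- by have := mem_succ (m p); rewrite mK.
- move=> z zp zs; have := sF (m p) z; rewrite mK => /(_ zp zs).
  by rewrite sm mK /L -sm.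
- by move=> w; rewrite -Lm => wp ws; have := sF p w wp ws; rewrite /L mK -sm.
Qed.
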